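(* Let $E$ be a graph, $K$ a field, and let $\{H_i\}_{i\in\Lambda}$ be a family of hereditary subsets of $E^0$ such that $H_i\cap H_j=\emptyset$ for every $i\ne j$. Then, in $L_K(E)$, $$I\Big(\overline{\bigcup_{i\in\Lambda}H_i}\Big)=I\Big(\bigcup_{i\in\Lambda}H_i\Big)=\bigoplus_{i\in\Lambda}I(H_i)=\bigoplus_{i\in\Lambda}I(\overline{H_i}).$$
   Context: A directed graph is $E=(E^0,E^1,r,s)$ with vertex set $E^0$, edge set $E^1$ and range and source maps $r,s:E^1\to E^0$ (arbitrary). A vertex $v$ is regular if $s^{-1}(v)$ is finite and nonempty. The Leavitt path algebra $L_K(E)$ is the $K$-algebra generated by $E^0\cup E^1\cup\{e^*: e\in E^1\}$ with relations: $vw=\delta_{v,w}v$ for $v,w\in E^0$; $s(e)e=er(e)=e$ and $r(e)e^*=e^*s(e)=e^*$ for $e\in E^1$; $e^*e'=\delta_{e,e'}r(e)$ for $e,e'\in E^1$; and $v=\sum_{s(e)=v}ee^*$ for every regular $v$. $I(Y)$ is the two-sided ideal generated by a set $Y$ of vertices. Write $v\ge w$ if there is a path from $v$ to $w$. $H\subseteq E^0$ is hereditary if $v\in H$ and $v\ge w$ imply $w\in H$. For a hereditary $H$, the saturated closure is $\overline H=\bigcup_{i\ge0}\Lambda_i(H)$, where $\Lambda_0(H)=H$ and $\Lambda_i(H)=\Lambda_{i-1}(H)\cup\{v \text{ regular}: r(s^{-1}(v))\subseteq\Lambda_{i-1}(H)\}$. *)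

(* Defs.v *)
From HB Require Import structures.
From mathcomp Require Import all_boot all_order all_algebra.
From mathcomp Require Import generic_quotient finmap.
From mathcomp Require Import all_classical.

Set Implicit Arguments.
Unset Strict Implicit.
Unset Printing Implicit Defensive.

Import GRing.Theory.
Local Open Scope classical_set_scope.
Local Open Scope ring_scope.
Local Open Scope quotient_scope.

Record graph := Graph {
  vertex : Type;
  edge : Type;
  src : edge -> vertex;
  rng : edge -> vertex }.

(* Classical equality and choice, so that finite sets of edges can be
   enumerated with [fset_set]. *)
HB.instance Definition _ (E : graph) := gen_eqMixin (edge E).
HB.instance Definition _ (E : graph) := gen_choiceMixin (edge E).

Section Graph.
Variable E : graph.

Definition out_edges (v : vertex E) : set (edge E) := src (g:=E) @^-1` [set v].

Definition regular (v : vertex E) : Prop :=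
  finite_set (out_edges v) /\ out_edges v !=set0.

Fixpoint is_path (v : vertex E) (p : seq (edge E)) (w : vertex E) : Prop :=
  if p is e :: p' then src e = v /\ is_path (rng e) p' w else v = w.

Definition reaches (v w : vertex E) : Prop := exists p, is_path v p w.

Definition hereditary (H : set (vertex E)) : Prop :=
  forall v w, H v -> reaches v w -> H w.

Fixpoint saturation_step (H : set (vertex E)) (i : nat) : set (vertex E) :=
  if i is j.+1 then
    saturation_step H j `|`
    [set v | regular v /\ rng (g:=E) @` out_edges v `<=` saturation_step H j]
  else H.

Definition saturated_closure (H : set (vertex E)) : set (vertex E) :=
  \bigcup_i saturation_step H i.

End Graph.

(* L_K(E) has no unit when E has infinitely many vertices, so it is presented
   as an associative K-algebra without unit: formal expressions in the
   generators, modulo the least congruence containing the axioms of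
   (non-unital) K-algebras and the defining relations. *)
Inductive lpa_term (K : fieldType) (E : graph) : Type :=
| Vert of vertex E
| Edge of edge E
| Ghost of edge E
| Zero
| Add of lpa_term K E & lpa_term K E
| Opp of lpa_term K E
| Scale of K & lpa_term K E
| Mul of lpa_term K E & lpa_term K E.

Arguments Vert K {E} _.
Arguments Edge K {E} _.
Arguments Ghost K {E} _.
Arguments Zero {K E}.

HB.instance Definition _ (K : fieldType) (E : graph) :=
  gen_eqMixin (lpa_term K E).
HB.instance Definition _ (K : fieldType) (E : graph) :=
  gen_choiceMixin (lpa_term K E).

Section LeavittPathAlgebra.
Variables (K : fieldType) (E : graph).
Local Notation term := (lpa_term K E).

Inductive lpa_eq : term -> term -> Prop :=
| lpaeq_refl x : lpa_eq x x
| lpaeq_sym x y : lpa_eq x y -> lpa_eq y x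
| lpaeq_trans y x z : lpa_eq x y -> lpa_eq y z -> lpa_eq x z
| lpaeq_add x x' y y' : lpa_eq x x' -> lpa_eq y y' -> lpa_eq (Add x y) (Add x' y')
| lpaeq_opp x x' : lpa_eq x x' -> lpa_eq (Opp x) (Opp x')
| lpaeq_scale a x x' : lpa_eq x x' -> lpa_eq (Scale a x) (Scale a x')
| lpaeq_mul x x' y y' : lpa_eq x x' -> lpa_eq y y' -> lpa_eq (Mul x y) (Mul x' y')
| lpaeq_addA x y z : lpa_eq (Add x (Add y z)) (Add (Add x y) z)
| lpaeq_addC x y : lpa_eq (Add x y) (Add y x)
| lpaeq_add0 x : lpa_eq (Add Zero x) x
| lpaeq_addN x : lpa_eq (Add (Opp x) x) Zero
| lpaeq_scaleA a b x : lpa_eq (Scale a (Scale b x)) (Scale (a * b) x)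
| lpaeq_scale1 x : lpa_eq (Scale 1 x) x
| lpaeq_scaleDr a x y : lpa_eq (Scale a (Add x y)) (Add (Scale a x) (Scale a y))
| lpaeq_scaleDl a b x : lpa_eq (Scale (a + b) x) (Add (Scale a x) (Scale b x))
| lpaeq_mulA x y z : lpa_eq (Mul x (Mul y z)) (Mul (Mul x y) z)
| lpaeq_mulDl x y z : lpa_eq (Mul (Add x y) z) (Add (Mul x z) (Mul y z))
| lpaeq_mulDr x y z : lpa_eq (Mul x (Add y z)) (Add (Mul x y) (Mul x z))
| lpaeq_scaleAl a x y : lpa_eq (Mul (Scale a x) y) (Scale a (Mul x y))
| lpaeq_scaleAr a x y : lpa_eq (Mul x (Scale a y)) (Scale a (Mul x y))
| lpaeq_vert_id v : lpa_eq (Mul (Vert K v) (Vert K v)) (Vert K v)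
| lpaeq_vert_orth v w : v <> w -> lpa_eq (Mul (Vert K v) (Vert K w)) Zero
| lpaeq_src_edge e : lpa_eq (Mul (Vert K (src e)) (Edge K e)) (Edge K e)
| lpaeq_edge_rng e : lpa_eq (Mul (Edge K e) (Vert K (rng e))) (Edge K e)
| lpaeq_rng_ghost e : lpa_eq (Mul (Vert K (rng e)) (Ghost K e)) (Ghost K e)
| lpaeq_ghost_src e : lpa_eq (Mul (Ghost K e) (Vert K (src e))) (Ghost K e)
| lpaeq_CK1_id e : lpa_eq (Mul (Ghost K e) (Edge K e)) (Vert K (rng e))
| lpaeq_CK1_orth e f : e <> f -> lpa_eq (Mul (Ghost K e) (Edge K f)) Zero
| lpaeq_CK2 v : regular v ->
    lpa_eq (Vert K v)
      (foldr (@Add K E) Zero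
         [seq Mul (Edge K e) (Ghost K e) | e <- fset_set (out_edges v)]).

Definition lpa_eqb (x y : term) : bool := `[< lpa_eq x y >].

Lemma lpa_eqb_refl : reflexive lpa_eqb.
Proof. by move=> x; apply/asboolP/lpaeq_refl. Qed.

Lemma lpa_eqb_sym : symmetric lpa_eqb.
Proof. by move=> x y; apply/asboolP/asboolP; apply: lpaeq_sym. Qed.

Lemma lpa_eqb_trans : transitive lpa_eqb.
Proof.
by move=> y x z /asboolP xy /asboolP yz; apply/asboolP/(lpaeq_trans xy yz).
Qed.

Canonical lpa_equiv := EquivRel lpa_eqb lpa_eqb_refl lpa_eqb_sym lpa_eqb_trans.

Definition lpa := {eq_quot lpa_equiv}.
HB.instance Definition _ := Choice.on lpa.
HB.instance Definition _ := EqQuotient.on lpa.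

Lemma lpa_eqP (x y : term) : \pi_lpa x = \pi_lpa y <-> lpa_eq x y.
Proof.
split; first by move=> /eqmodP /asboolP.
by move=> xy; apply/eqmodP/asboolP.
Qed.

Lemma lpa_reprK (x : lpa) : \pi_lpa (repr x) = x.
Proof. exact: reprK. Qed.

Lemma lpa_repr_pi (x : term) : lpa_eq (repr (\pi_lpa x)) x.
Proof. by apply/lpa_eqP; rewrite lpa_reprK. Qed.

Definition lpa_add (x y : lpa) : lpa := \pi_lpa (Add (repr x) (repr y)).
Definition lpa_opp (x : lpa) : lpa := \pi_lpa (Opp (repr x)).
Definition lpa_scale (a : K) (x : lpa) : lpa := \pi_lpa (Scale a (repr x)).
Definition lpa_mul (x y : lpa) : lpa := \pi_lpa (Mul (repr x) (repr y)).

Lemma pi_add x y : \pi_lpa (Add x y) = lpa_add (\pi_lpa x) (\pi_lpa y).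
Proof. by apply/lpa_eqP/lpaeq_add; apply/lpaeq_sym/lpa_repr_pi. Qed.

Lemma pi_opp x : \pi_lpa (Opp x) = lpa_opp (\pi_lpa x).
Proof. by apply/lpa_eqP/lpaeq_opp; apply/lpaeq_sym/lpa_repr_pi. Qed.

Lemma pi_scale a x : \pi_lpa (Scale a x) = lpa_scale a (\pi_lpa x).
Proof. by apply/lpa_eqP/lpaeq_scale; apply/lpaeq_sym/lpa_repr_pi. Qed.

Lemma pi_mul x y : \pi_lpa (Mul x y) = lpa_mul (\pi_lpa x) (\pi_lpa y).
Proof. by apply/lpa_eqP/lpaeq_mul; apply/lpaeq_sym/lpa_repr_pi. Qed.

Lemma lpa_piW (P : lpa -> Prop) : (forall t, P (\pi_lpa t)) -> forall x, P x.
Proof. by move=> Ppi x; rewrite -(lpa_reprK x). Qed.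

Lemma lpa_addA : associative lpa_add.
Proof.
elim/lpa_piW=> x; elim/lpa_piW=> y; elim/lpa_piW=> z.
by rewrite -!pi_add; apply/lpa_eqP/lpaeq_addA.
Qed.

Lemma lpa_addC : commutative lpa_add.
Proof.
by elim/lpa_piW=> x; elim/lpa_piW=> y; rewrite -!pi_add; apply/lpa_eqP/lpaeq_addC.
Qed.

Lemma lpa_add0 : left_id (\pi_lpa Zero) lpa_add.
Proof. by elim/lpa_piW=> x; rewrite -pi_add; apply/lpa_eqP/lpaeq_add0. Qed.

Lemma lpa_addN : left_inverse (\pi_lpa Zero) lpa_opp lpa_add.
Proof.
by elim/lpa_piW=> x; rewrite -pi_opp -pi_add; apply/lpa_eqP/lpaeq_addN.
Qed.

HB.instance Definition _ :=
  GRing.isZmodule.Build lpa lpa_addA lpa_addC lpa_add0 lpa_addN.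

Lemma lpa_scaleA a b (x : lpa) :
  lpa_scale a (lpa_scale b x) = lpa_scale (a * b) x.
Proof.
by elim/lpa_piW: x => x; rewrite -!pi_scale; apply/lpa_eqP/lpaeq_scaleA.
Qed.

Lemma lpa_scale1 : left_id 1 lpa_scale.
Proof. by elim/lpa_piW=> x; rewrite -pi_scale; apply/lpa_eqP/lpaeq_scale1. Qed.

Lemma lpa_scaleDr : right_distributive lpa_scale +%R.
Proof.
move=> a; elim/lpa_piW=> x; elim/lpa_piW=> y.
by rewrite -[_ + _]pi_add -!pi_scale -[RHS]pi_add; apply/lpa_eqP/lpaeq_scaleDr.
Qed.

Lemma lpa_scaleDl (x : lpa) : {morph lpa_scale^~ x : a b / a + b}.
Proof.
elim/lpa_piW: x => x a b.
by rewrite /= -!pi_scale -[RHS]pi_add; apply/lpa_eqP/lpaeq_scaleDl.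
Qed.

HB.instance Definition _ := GRing.Zmodule_isLmodule.Build K lpa
  lpa_scaleA lpa_scale1 lpa_scaleDr lpa_scaleDl.

Lemma lpa_mulA : associative lpa_mul.
Proof.
elim/lpa_piW=> x; elim/lpa_piW=> y; elim/lpa_piW=> z.
by rewrite -!pi_mul; apply/lpa_eqP/lpaeq_mulA.
Qed.

Lemma lpa_mulDl : left_distributive lpa_mul +%R.
Proof.
elim/lpa_piW=> x; elim/lpa_piW=> y; elim/lpa_piW=> z.
by rewrite -[_ + _]pi_add -!pi_mul -[RHS]pi_add; apply/lpa_eqP/lpaeq_mulDl.
Qed.

Lemma lpa_mulDr : right_distributive lpa_mul +%R.
Proof.
elim/lpa_piW=> x; elim/lpa_piW=> y; elim/lpa_piW=> z.
by rewrite -[_ + _]pi_add -!pi_mul -[RHS]pi_add; apply/lpa_eqP/lpaeq_mulDr.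
Qed.

Lemma lpa_scaleAl (a : K) (x y : lpa) : lpa_mul (a *: x) y = a *: lpa_mul x y.
Proof.
elim/lpa_piW: x => x; elim/lpa_piW: y => y.
by rewrite -[a *: _]pi_scale -!pi_mul -[RHS]pi_scale; apply/lpa_eqP/lpaeq_scaleAl.
Qed.

Lemma lpa_scaleAr (a : K) (x y : lpa) : lpa_mul x (a *: y) = a *: lpa_mul x y.
Proof.
elim/lpa_piW: x => x; elim/lpa_piW: y => y.
by rewrite -[a *: _]pi_scale -!pi_mul -[RHS]pi_scale; apply/lpa_eqP/lpaeq_scaleAr.
Qed.

Definition lpa_vert (v : vertex E) : lpa := \pi_lpa (Vert K v).
Definition lpa_edge (e : edge E) : lpa := \pi_lpa (Edge K e).
Definition lpa_ghost (e : edge E) : lpa := \pi_lpa (Ghost K e).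

Lemma lpa_CK2 (v : vertex E) : regular v ->
  lpa_vert v = \sum_(e \in out_edges v) lpa_mul (lpa_edge e) (lpa_ghost e).
Proof.
move=> vreg; rewrite fsbig_finite /=; last by case: vreg.
rewrite /lpa_vert (iffRL (lpa_eqP _ _) (lpaeq_CK2 vreg)).
elim: (enum_fset _) => [|e s IHs] /=; first by rewrite big_nil.
by rewrite big_cons pi_add IHs pi_mul.
Qed.

Definition two_sided_ideal (J : set lpa) : Prop :=
  [/\ J 0,
      forall x y, J x -> J y -> J (x + y),
      forall (a : K) x, J x -> J (a *: x),
      forall x y, J y -> J (lpa_mul x y) &
      forall x y, J x -> J (lpa_mul x y)].

Definition ideal_gen (Y : set (vertex E)) : set lpa :=
  smallest two_sided_ideal (lpa_vert @` Y).

End LeavittPathAlgebra.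

Arguments ideal_gen K {E} Y.

Section DirectSum.
Variables (V : zmodType) (I : Type).
Implicit Type J : I -> set V.

Definition family_sum J : set V :=
  [set x | exists (s : seq {classic I}) (f : I -> V),
    [/\ uniq s, forall i, J i (f i) & x = \sum_(i <- s) f i]].

Definition independent_family J : Prop :=
  forall (s : seq {classic I}) (f : I -> V),
    uniq s -> (forall i, J i (f i)) -> \sum_(i <- s) f i = 0 ->
    forall i, i \in s -> f i = 0.

Definition is_direct_sum (X : set V) J : Prop :=
  X = family_sum J /\ independent_family J.

End DirectSum.

(* Main.v *)
Require Import Defs.
From mathcomp Require Import all_boot all_algebra all_classical.
Local Open Scope classical_set_scope.

(* For hereditary H, every element of I(H) is a finite sum of monomials
   e_1 ... e_n v z with v in H, and v I(H') = 0 as soon as H' is hereditary and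
   disjoint from H. If a sum of elements of the I(H_i) vanishes, each summand x
   of index i is thus killed by v L for all v in H_i. Such an x in I(H_i) is
   zero: if e_1 ... e_n v z has minimal length in an expression of x, the
   operator e_1 ... e_n v e_n^* ... e_1^* kills x, fixes that monomial, and
   fixes or kills every other monomial of the expression, so the fixed ones sum
   to 0 and can be removed. *)

Set Implicit Arguments.
Unset Strict Implicit.
Unset Printing Implicit Defensive.

Import GRing.Theory.
Local Open Scope ring_scope.

Local Notation "x ** y" := (lpa_mul x y) (at level 40, left associativity).

Section LeavittPathAlgebraTheory.
Variables (K : fieldType) (E : graph).
Local Notation L := (lpa K E).
Local Notation vert := (@lpa_vert K E).
Local Notation edg := (@lpa_edge K E).
Local Notation gho := (@lpa_ghost K E).
Implicit Types (x y z m : L) (v w : vertex E) (e f : edge E) (p q : seq (edge E)).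
Implicit Types (H Y : set (vertex E)).

(** * Arithmetic and defining relations of the algebra *)

Lemma lpa_mul0l x : 0 ** x = 0 :> L.
Proof. by apply: (addrI (0 ** x)); rewrite -lpa_mulDl !addr0. Qed.

Lemma lpa_mul0r x : x ** 0 = 0 :> L.
Proof. by apply: (addrI (x ** 0)); rewrite -lpa_mulDr !addr0. Qed.

Lemma lpa_mulNr x y : x ** (- y) = - (x ** y).
Proof. by apply/eqP; rewrite -addr_eq0 -lpa_mulDr addNr lpa_mul0r. Qed.

Lemma lpa_mul_sumr (I : Type) (s : seq I) (P : pred I) (F : I -> L) x :
  x ** \sum_(i <- s | P i) F i = \sum_(i <- s | P i) x ** F i.
Proof. by apply: (big_morph (lpa_mul x) (@lpa_mulDr _ _ x) (lpa_mul0r x)). Qed.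

Lemma lpa_mul_suml (I : Type) (s : seq I) (P : pred I) (F : I -> L) x :
  (\sum_(i <- s | P i) F i) ** x = \sum_(i <- s | P i) F i ** x.
Proof.
apply: (big_morph (fun y => y ** x) _ (lpa_mul0l x)) => y z.
exact: lpa_mulDl.
Qed.

Lemma vert_id v : vert v ** vert v = vert v.
Proof. by rewrite -Defs.pi_mul; apply/lpa_eqP/lpaeq_vert_id. Qed.

Lemma vert_orth v w : v <> w -> vert v ** vert w = 0.
Proof. by move=> vw; rewrite -Defs.pi_mul; apply/lpa_eqP/lpaeq_vert_orth. Qed.

Lemma src_edge e : vert (src e) ** edg e = edg e.
Proof. by rewrite -Defs.pi_mul; apply/lpa_eqP/lpaeq_src_edge. Qed.

Lemma edge_rng e : edg e ** vert (rng e) = edg e.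
Proof. by rewrite -Defs.pi_mul; apply/lpa_eqP/lpaeq_edge_rng. Qed.

Lemma rng_ghost e : vert (rng e) ** gho e = gho e.
Proof. by rewrite -Defs.pi_mul; apply/lpa_eqP/lpaeq_rng_ghost. Qed.

Lemma ghost_src e : gho e ** vert (src e) = gho e.
Proof. by rewrite -Defs.pi_mul; apply/lpa_eqP/lpaeq_ghost_src. Qed.

Lemma ghost_edge e : gho e ** edg e = vert (rng e).
Proof. by rewrite -Defs.pi_mul; apply/lpa_eqP/lpaeq_CK1_id. Qed.

Lemma ghost_edge_orth e f : e <> f -> gho e ** edg f = 0.
Proof. by move=> ef; rewrite -Defs.pi_mul; apply/lpa_eqP/lpaeq_CK1_orth. Qed.

Lemma vert_edge_orth v e : v <> src e -> vert v ** edg e = 0.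
Proof. by move=> ve; rewrite -src_edge lpa_mulA vert_orth // lpa_mul0l. Qed.

Lemma ghost_vert_orth e v : v <> src e -> gho e ** vert v = 0.
Proof.
by move=> ve; rewrite -ghost_src -lpa_mulA vert_orth ?lpa_mul0r // => /esym.
Qed.

(** Opposites need no clause of their own, since -x = (-1) x. *)
Lemma lpa_ind (P : L -> Prop) :
    (forall v, P (vert v)) -> (forall e, P (edg e)) -> (forall e, P (gho e)) ->
    P 0 -> (forall x y, P x -> P y -> P (x + y)) ->
    (forall (a : K) x, P x -> P (a *: x)) ->
    (forall x y, P x -> P y -> P (x ** y)) ->
  forall x, P x.
Proof.
move=> Pv Pe Pg P0 PD PZ PM; elim/lpa_piW; elim=> [v|e|e||x Px y Py|x Px|a x Px|x Px y Py].
- exact: Pv.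
- exact: Pe.
- exact: Pg.
- exact: P0.
- by rewrite Defs.pi_add; apply: PD.
- by have := PZ (-1) _ Px; rewrite scaleN1r Defs.pi_opp.
- by rewrite Defs.pi_scale; apply: PZ.
- by rewrite Defs.pi_mul; apply: PM.
Qed.

(** * Ideals generated by vertices, and saturation *)

Lemma ideal_gen_ideal Y : two_sided_ideal (ideal_gen K Y).
Proof.
split.
- by move=> J [[]].
- move=> x y Ix Iy J JI; have [[_ JD _ _ _] _] := JI.
  by apply: JD; [apply: Ix | apply: Iy].
- move=> a x Ix J JI; have [[_ _ JZ _ _] _] := JI.
  by apply: JZ; apply: Ix.
- move=> x y Iy J JI; have [[_ _ _ JM _] _] := JI.
  by apply: JM; apply: Iy.
- move=> x y Ix J JI; have [[_ _ _ _ JM] _] := JI.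
  by apply: JM; apply: Ix.
Qed.

Lemma ideal_gen_vert Y v : Y v -> ideal_gen K Y (vert v).
Proof. by move=> Yv J [_]; apply; exists v. Qed.

Lemma ideal_gen_min (J : set L) Y : two_sided_ideal J ->
  (forall v, Y v -> J (vert v)) -> ideal_gen K Y `<=` J.
Proof. by move=> idJ YJ x; apply; split=> // _ [v Yv <-]; apply: YJ. Qed.

Lemma ideal_gen_le Y Y' : Y `<=` Y' -> ideal_gen K Y `<=` ideal_gen K Y'.
Proof.
move=> YY'; apply: ideal_gen_min (ideal_gen_ideal _) _ => v /YY'.
exact: ideal_gen_vert.
Qed.

Lemma ideal_sum (J : set L) (I : Type) (s : seq I) (P : pred I) (F : I -> L) :
  two_sided_ideal J -> (forall i, P i -> J (F i)) ->
  J (\sum_(i <- s | P i) F i).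
Proof. by case=> J0 JD _ _ _ JF; apply: big_ind. Qed.

(** Induction on the saturation stage: a regular v added at stage n + 1 is the sum of the e e^* = e
    r(e) e^*, and each r(e) lies in stage n. *)
Lemma ideal_gen_saturated Y :
  ideal_gen K (saturated_closure Y) = ideal_gen K Y.
Proof.
apply/seteqP; split; last by apply: ideal_gen_le => v Yv; exists 0.
have [I0 ID _ IMl IMr] := ideal_gen_ideal Y.
apply: ideal_gen_min (ideal_gen_ideal _) _ => v [n _].
elim: n v => [|n IHn] v /=; first exact: ideal_gen_vert.
case=> [/IHn //|[vreg rngs]]; rewrite lpa_CK2 // fsbig_finite; last by case: vreg.
rewrite big_seq; apply: ideal_sum (ideal_gen_ideal _) _ => e.
rewrite in_fset_set; last by case: vreg.
rewrite inE => ev; rewrite -edge_rng; apply: (IMr); apply: (IMl); apply: (IHn).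
by apply: rngs; exists e.
Qed.

(** * Path operators and monomials *)

Lemma hereditary_rng H e : hereditary H -> H (src e) -> H (rng e).
Proof. by move=> hH He; apply: (hH _ _ He); exists [:: e]. Qed.

(** Paths act as operators on [L]: without a unit, the empty product would not be an element. *)
Fixpoint path_mul p x : L := if p is e :: p' then edg e ** path_mul p' x else x.

(** The ghost of the first edge acts first, so this is left multiplication by e_n^* ... e_1^* when p
    = e_1 ... e_n. *)
Fixpoint ghosts_mul p x : L :=
  if p is e :: p' then ghosts_mul p' (gho e ** x) else x.

Definition path_range_proj p v x : L :=
  path_mul p (vert v ** ghosts_mul p x).

(* p need not be a path, and v need not be its range; otherwise m = 0. *)
Definition monomial H n m : Prop :=
  exists p v z, [/\ size p = n, H v & m = path_mul p (vert v ** z)].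

Lemma path_mulD p : {morph path_mul p : x y / x + y}.
Proof. by elim: p => //= e p IHp x y; rewrite IHp lpa_mulDr. Qed.

Lemma path_mul0 p : path_mul p 0 = 0.
Proof. by elim: p => //= e p ->; rewrite lpa_mul0r. Qed.

Lemma path_mulZ p (a : K) x : path_mul p (a *: x) = a *: path_mul p x.
Proof. by elim: p => //= e p ->; rewrite lpa_scaleAr. Qed.

Lemma path_mulMr p x y : path_mul p x ** y = path_mul p (x ** y).
Proof. by elim: p => //= e p <-; rewrite lpa_mulA. Qed.

Lemma path_range_projD p v : {morph path_range_proj p v : x y / x + y}.
Proof.
move=> x y; rewrite /path_range_proj -path_mulD -lpa_mulDr; congr path_mul.
congr (_ ** _); elim: p x y => //= e p IHp x y.
by rewrite lpa_mulDr IHp.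
Qed.

Lemma path_range_proj0 p v : path_range_proj p v 0 = 0.
Proof. by apply: (addrI (path_range_proj p v 0)); rewrite -path_range_projD !addr0. Qed.

Lemma path_range_proj_sum p v (s : seq L) :
  path_range_proj p v (\sum_(m <- s) m) = \sum_(m <- s) path_range_proj p v m.
Proof.
apply: (big_morph (path_range_proj p v)) => [x y|].
  exact: path_range_projD.
exact: path_range_proj0.
Qed.

(** Brings the operator to the form v a x, to which a hypothesis on v L x applies. The factor v
    supplies a when [p] is empty. *)
Lemma ghosts_mul_absorb p v x : exists a, vert v ** ghosts_mul p x = vert v ** (a ** x).
Proof.
elim: p x => [|e p IHp] x /=; first by exists (vert v); rewrite lpa_mulA vert_id.
by have [a ->] := IHp (gho e ** x); exists (a ** gho e); rewrite !lpa_mulA.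
Qed.

Lemma vert_monomial v q w z (m := path_mul q (vert w ** z)) :
  vert v ** m = m \/ vert v ** m = 0.
Proof.
rewrite {}/m; case: q => [|e q] /=; rewrite lpa_mulA.
  have [->|vw] := pselect (v = w); first by left; rewrite vert_id.
  by right; rewrite vert_orth // lpa_mul0l.
have [->|ve] := pselect (v = src e); first by left; rewrite src_edge.
by right; rewrite vert_edge_orth // lpa_mul0l.
Qed.

(** Edges cancel one by one through e^* f = 0 or r(e). As [p] is not longer than [q], no ghost edge
    is left to act on w z. *)
Lemma path_range_proj_monomial p v q w z (m := path_mul q (vert w ** z)) :
  (size p <= size q)%N ->
  path_range_proj p v m = m \/ path_range_proj p v m = 0.
Proof.
rewrite {}/m; elim: p q => [|e p IHp] q; first by move=> _; apply: vert_monomial.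
case: q => // f q; rewrite ltnS => /IHp; rewrite /path_range_proj /= lpa_mulA.
have [<-|ef] := pselect (e = f); last first.
  by right; rewrite ghost_edge_orth // lpa_mul0l [path_mul _ _]path_range_proj0 lpa_mul0r.
rewrite ghost_edge.
have [-> [->|->]|-> _] := vert_monomial (rng e) q w z; [by left|right..].
  by rewrite lpa_mul0r.
by rewrite [path_mul _ _]path_range_proj0 lpa_mul0r.
Qed.

(** With the same path and vertex, every cancellation succeeds, which excludes the outcome 0 unless
    the monomial is itself 0. *)
Lemma path_range_proj_id p v z (m := path_mul p (vert v ** z)) :
  path_range_proj p v m = m.
Proof.
rewrite {}/m; elim: p => [|e p IHp]; rewrite /path_range_proj /= lpa_mulA.
  by rewrite vert_id.
rewrite ghost_edge -[path_mul _ (_ ** ghosts_mul _ _)]/(path_range_proj _ _ _).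
(* If r(e) kills the tail, then so does e = e r(e), and both sides are 0. *)
have [->|r0] := vert_monomial (rng e) p v z; first by rewrite IHp.
by rewrite r0 path_range_proj0 lpa_mul0r -edge_rng -lpa_mulA r0 lpa_mul0r.
Qed.

(** * Finite sums of monomials: ideal structure and annihilators *)

Definition monomial_sum H : set L :=
  [set x | exists2 s : seq L,
     (forall m, m \in s -> exists n, monomial H n m) & x = \sum_(m <- s) m].

Lemma monomial_sum1 H n m : monomial H n m -> monomial_sum H m.
Proof.
move=> Hm; exists [:: m]; last by rewrite big_seq1.
by move=> m'; rewrite inE => /eqP->; exists n.
Qed.

Lemma monomial_sum0 H : monomial_sum H 0.
Proof. by exists [::] => //; rewrite big_nil. Qed.

Lemma monomial_sumD H x y :
  monomial_sum H x -> monomial_sum H y -> monomial_sum H (x + y).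
Proof.
move=> [s Hs ->] [t Ht ->]; exists (s ++ t); last by rewrite big_cat.
by move=> m; rewrite mem_cat => /orP[/Hs|/Ht].
Qed.

Lemma monomial_sum_additive H (F : L -> L) :
    F 0 = 0 -> {morph F : x y / x + y} ->
    (forall n m, monomial H n m -> monomial_sum H (F m)) ->
  forall x, monomial_sum H x -> monomial_sum H (F x).
Proof.
move=> F0 FD Fm _ [s Hs ->]; rewrite (big_morph F FD F0) big_seq.
apply: big_ind => [||m /Hs[n /Fm] //]; first exact: monomial_sum0.
exact: monomial_sumD.
Qed.

(** Left multipliers are treated by induction on their construction. The delicate generator is f^*
    acting on v z with v = s(f): the result f^* z = r(f) f^* z is again a monomial because r(f) is
    in [H] by heredity. *)
Lemma monomial_sum_ideal H : hereditary H -> two_sided_ideal (monomial_sum H).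
Proof.
move=> hH; split; [exact: monomial_sum0|exact: monomial_sumD|..].
- move=> a; apply: monomial_sum_additive; [exact: scaler0|exact: scalerDr|].
  move=> n _ [p [v [z [sp Hv ->]]]]; apply: (@monomial_sum1 _ n).
  by exists p, v, (a *: z); rewrite -path_mulZ lpa_scaleAr.
- elim/lpa_ind=> [w|f|f||x y IHx IHy|a x IHx|x y IHx IHy] y'.
  + apply: monomial_sum_additive; [exact: lpa_mul0r|exact: lpa_mulDr|].
    move=> n _ [p [v [z [sp Hv ->]]]].
    have [->|->] := vert_monomial w p v z; last exact: monomial_sum0.
    by apply: (@monomial_sum1 _ n); exists p, v, z.
  + apply: monomial_sum_additive; [exact: lpa_mul0r|exact: lpa_mulDr|].
    move=> n _ [p [v [z [_ Hv ->]]]].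
    by apply: (@monomial_sum1 _ (size p).+1); exists (f :: p), v, z.
  + apply: monomial_sum_additive; [exact: lpa_mul0r|exact: lpa_mulDr|].
    move=> _ _ [[|e p] [v [z [_ Hv ->]]]] /=; rewrite lpa_mulA.
      have [vf|vf] := pselect (v = src f); last first.
        by rewrite ghost_vert_orth // lpa_mul0l; apply: monomial_sum0.
      rewrite vf ghost_src -rng_ghost -lpa_mulA.
      apply: (@monomial_sum1 _ 0); exists [::], (rng f), (gho f ** z).
      by split=> //; apply: hereditary_rng; rewrite -?vf.
    have [<-|fe] := pselect (f = e); last first.
      by rewrite ghost_edge_orth // lpa_mul0l; apply: monomial_sum0.
    rewrite ghost_edge.
    have [->|->] := vert_monomial (rng f) p v z; last exact: monomial_sum0.
    by apply: (@monomial_sum1 _ (size p)); exists p, v, z.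
  + by rewrite lpa_mul0l => _; apply: monomial_sum0.
  + by move=> Sy; rewrite lpa_mulDl; apply: monomial_sumD; [apply: IHx|apply: IHy].
  (* The scalar moves to the right factor, where it is absorbed into the z of each monomial. *)
  + rewrite lpa_scaleAl -lpa_scaleAr => Sy; apply: IHx.
    move: Sy; apply: monomial_sum_additive; [exact: scaler0|exact: scalerDr|].
    move=> n _ [p [v [z [sp Hv ->]]]]; apply: (@monomial_sum1 _ n).
    by exists p, v, (a *: z); rewrite -path_mulZ lpa_scaleAr.
  + by move=> Sy; rewrite -lpa_mulA; apply/IHx/IHy.
- move=> x0 y; move: x0; apply: (@monomial_sum_additive _ (fun x => x ** y)).
  + exact: lpa_mul0l.
  + by move=> ? ?; rewrite lpa_mulDl.
  move=> n _ [p [v [z [sp Hv ->]]]]; apply: (@monomial_sum1 _ n).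
  by exists p, v, (z ** y); rewrite path_mulMr lpa_mulA.
Qed.

(** A vertex v = v v of [H] is a monomial with empty path, so minimality of the generated ideal
    applies. *)
Lemma ideal_gen_monomial_sum H x :
  hereditary H -> ideal_gen K H x -> monomial_sum H x.
Proof.
move=> hH; apply: ideal_gen_min (monomial_sum_ideal hH) _ _ => v Hv.
by apply: (@monomial_sum1 _ 0); exists [::], v, (vert v); rewrite /= vert_id.
Qed.

(** Against a monomial of [H'], v either dies at the first edge e or equals s(e); then e = e r(e)
    hands the question to r(e), again in [H]. At the end a vertex of [H] meets one of [H'], and
    these differ. *)
Lemma vert_ideal_gen_orth H H' v x : hereditary H -> hereditary H' ->
  H `&` H' = set0 -> H v -> ideal_gen K H' x -> vert v ** x = 0.
Proof.
move=> hH hH' HH' Hv /(ideal_gen_monomial_sum hH')[s Hs ->].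
rewrite lpa_mul_sumr big_seq big1 // => m /Hs[n [p [w [z [_ Hw ->]]]]].
elim: p v Hv => [|e p IHp] v Hv /=; rewrite lpa_mulA.
  rewrite vert_orth ?lpa_mul0l // => vw.
  have : (H `&` H') w by split=> //; rewrite -vw.
  by rewrite HH'.
have [ve|ve] := pselect (v = src e); last by rewrite vert_edge_orth // lpa_mul0l.
rewrite ve src_edge -edge_rng -lpa_mulA IHp ?lpa_mul0r //.
by apply: hereditary_rng; rewrite -?ve.
Qed.

Lemma monomial_sum_ann0 H x : monomial_sum H x ->
  (forall v y, H v -> vert v ** (y ** x) = 0) -> x = 0.
Proof.
(* Induction on the number of terms: x stays the same while its expression shrinks. *)
move=> [s]; have [k] := ubnP (size s).
elim: k => // k IHk in s x *; rewrite ltnS => sk Hs xE ann.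
have [s0|[m0 m0s]] : s = [::] \/ exists m, m \in s.
  by case: (s) => [|m s']; [left|right; exists m; rewrite mem_head].
  by rewrite xE s0 big_nil.
(* One element may be a monomial of several lengths, so the minimum is taken over all presentations
   of all terms. *)
pose P n := `[< exists2 m, m \in s & monomial H n m >].
have exP : exists n, P n by have [n] := Hs _ m0s; exists n; apply/asboolP; exists m0.
case: (ex_minnP exP) => n /asboolP[m ms [p [v [z [sp Hv mE]]]]] min_n.
pose T := path_range_proj p v.
have Tx : T x = 0.
  rewrite /T /path_range_proj; have [a ->] := ghosts_mul_absorb p v x.
  by rewrite ann // path_mul0.
have Ts m' : m' \in s -> T m' = m' \/ T m' = 0.
  move=> m's; have [n' Hm'] := Hs _ m's; have [q [w [z' [sq _ m'E]]]] := Hm'.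
  rewrite m'E; apply: path_range_proj_monomial; rewrite sp sq.
  by apply: min_n; apply/asboolP; exists m'.
have Tm : T m = m by rewrite mE; apply: path_range_proj_id.
apply: (IHk [seq m' <- s | T m' != m']) ann.
(* The discarded terms include [m], so the list is strictly shorter. *)
- apply: leq_trans sk; rewrite size_filter -(count_predC (fun m' => T m' != m')).
  rewrite -[X in (X < _)%N]addn0 ltn_add2l -has_count; apply/hasP.
  by exists m => //=; rewrite negbK Tm.
- by move=> m'; rewrite mem_filter => /andP[_ /Hs].
suff fixed0 : \sum_(m' <- s | T m' == m') m' = 0.
  by rewrite big_filter xE (bigID (fun m' => T m' == m')) /= fixed0 add0r.
(* Expand 0 = T x termwise: fixed terms contribute themselves, the others 0. *)
rewrite -[RHS]Tx xE /T path_range_proj_sum big_mkcond [LHS]big_seq [RHS]big_seq.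
by apply: eq_bigr => m' /Ts; rewrite -/T => -[|] ->; rewrite ?eqxx //; case: eqP.
Qed.

(** * Sums of families of ideals, and independence *)

Lemma family_sum_ideal (Lam : Type) (J : Lam -> set L) :
  (forall i, two_sided_ideal (J i)) -> two_sided_ideal (family_sum J).
Proof.
move=> idJ.
have J0 i : J i 0 by case: (idJ i).
split.
- by exists [::], (fun=> 0); rewrite big_nil.
(* To add two sums, both are extended to a common index list. The cutoff is needed because [f] may
   be nonzero outside [s]. *)
- have ext (s u : seq {classic Lam}) (f : Lam -> L) :
      uniq s -> uniq u -> {subset s <= u} ->
    \sum_(i <- s) f i = \sum_(i <- u) (if i \in s then f i else 0).
    move=> us uu su; rewrite -big_mkcond -[RHS]big_filter; apply: perm_big.
    apply: uniq_perm; rewrite ?filter_uniq // => i; rewrite mem_filter.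
    by apply/idP/andP => [si|[]//]; split=> //; apply: su.
  move=> _ _ [s [f [us Jf ->]]] [t [g [ut Jg ->]]].
  pose u := undup (s ++ t).
  exists u, (fun i : {classic Lam} =>
    (if i \in s then f i else 0) + (if i \in t then g i else 0)).
  split; first exact: undup_uniq.
    by move=> i; have [_ JD _ _ _] := idJ i; apply: JD; case: ifP.
  rewrite big_split /= -!ext ?undup_uniq // => i it.
  + by rewrite mem_undup mem_cat it orbT.
  + by rewrite mem_undup mem_cat it.
- move=> a _ [s [f [us Jf ->]]]; exists s, (fun i => a *: f i).
  by rewrite scaler_sumr; split=> // i; case: (idJ i) => _ _ + _ _; apply.
- move=> x _ [s [f [us Jf ->]]]; exists s, (fun i => x ** f i).
  by rewrite lpa_mul_sumr; split=> // i; case: (idJ i) => _ _ _ + _; apply.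
- move=> _ y [s [f [us Jf ->]]]; exists s, (fun i => f i ** y).
  by rewrite lpa_mul_suml; split=> // i; case: (idJ i) => _ _ _ _; apply.
Qed.

Lemma ideal_gen_bigcup (Lam : Type) (Y : Lam -> set (vertex E)) :
  ideal_gen K (\bigcup_i Y i) = family_sum (fun i => ideal_gen K (Y i)).
Proof.
have idY i := ideal_gen_ideal (Y i).
apply/seteqP; split.
  apply: ideal_gen_min (family_sum_ideal idY) _ => v [i _ Yv].
  (* The value 0 off [i] keeps the function inside every ideal of the family. *)
  exists [:: i], (fun j : {classic Lam} => if j == i then vert v else 0).
  split=> //; last by rewrite big_seq1 eqxx.
  move=> j; case: eqP => [->|_]; first exact: ideal_gen_vert.
  by case: (idY j).
move=> _ [s [f [_ Jf ->]]]; apply: ideal_sum (ideal_gen_ideal _) _ => i _.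
by move: (Jf i); apply: ideal_gen_le; apply: bigcup_sup.
Qed.

Lemma ideal_gen_independent (Lam : Type) (H : Lam -> set (vertex E)) :
    (forall i, hereditary (H i)) ->
    (forall i j, i <> j -> H i `&` H j = set0) ->
  independent_family (fun i => ideal_gen K (H i)).
Proof.
move=> hH dH s f us If sum0 i si.
apply: (monomial_sum_ann0 (ideal_gen_monomial_sum (hH i) (If i))) => v y Hv.
(* The other summands, multiplied by y, stay in their ideals I(H_j), which v kills. *)
have -> : f i = - \sum_(j <- s | j != i) f j.
  by apply/eqP; rewrite -addr_eq0 -(bigD1_seq i) //= sum0.
rewrite !lpa_mulNr !lpa_mul_sumr big1 ?oppr0 // => j /eqP ji.
apply: (vert_ideal_gen_orth (hH i) (hH j)) => //; first by apply: dH => /esym.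
by have [_ _ _ + _] := ideal_gen_ideal (H j); apply.
Qed.

End LeavittPathAlgebraTheory.

Theorem proposition1p6 (K : fieldType) (E : graph) (Lam : Type)
  (H : Lam -> set (vertex E))
  (H_hereditary : forall i, hereditary (H i))
  (H_disjoint : forall i j, i <> j -> H i `&` H j = set0) :
  [/\ ideal_gen K (saturated_closure (\bigcup_i H i)) =
        ideal_gen K (\bigcup_i H i),
      is_direct_sum (ideal_gen K (\bigcup_i H i))
        (fun i => ideal_gen K (H i)) &
      is_direct_sum (ideal_gen K (\bigcup_i H i))
        (fun i => ideal_gen K (saturated_closure (H i)))].
Proof.
have sumH : is_direct_sum (ideal_gen K (\bigcup_i H i)) (fun i => ideal_gen K (H i)).
  by split; [apply: ideal_gen_bigcup | apply: ideal_gen_independent].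
split=> //; first exact: ideal_gen_saturated.
rewrite (_ : (fun i => _) = fun i => ideal_gen K (H i)) //.
by apply/funext => i; apply: ideal_gen_saturated.
Qed.
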